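(* Let $\{S_i\}_{i\in I}$, $I=\{1,\ldots,n\}$, be a finite family of finite nonabelian simple groups such that no $S_i$ is a subfactor of any other, and let $\mathcal{V}=\mathrm{Var}(\{S_i\}_{i\in I})$. Let $G$ be a finitely generated group in $\mathcal{V}$. Then there exist integers $m_1,\ldots,m_n\ge 0$ and a group $K$ such that $$G\cong S_1^{m_1}\times\cdots\times S_n^{m_n}\times K,$$ where $K$ is in the variety generated by the proper subfactors of all the $S_i$.
   Context: A variety of groups is a class of groups closed under taking quotients, subgroups and arbitrary direct products. $\mathrm{Var}(\mathcal{X})$, the variety generated by a collection $\mathcal{X}$ of groups, is the smallest variety containing $\mathcal{X}$. A subfactor of a group $G$ is any group of the form $H/N$ where $H$ is a subgroup of $G$ and $N\triangleleft H$; it is called proper except in the case where $H=G$ and $N=\{e\}$. ''$S_i$ is a subfactor of $S_j$'' is understood up to isomorphism, and ''no $S_i$ is a subfactor of any other'' means that for $i\neq j$, $S_i$ is not isomorphic to a subfactor of $S_j$ (in particular the $S_i$ are pairwise non-isomorphic). $S^m$ denotes the direct product of $m$ copies of $S$. *)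

(* Defs.v *)
From HB Require Import structures.
From mathcomp Require Import all_boot all_fingroup all_solvable.
From mathcomp Require Import boolp.

Set Implicit Arguments.
Unset Strict Implicit.
Unset Printing Implicit Defensive.

Local Open Scope group_scope.

(* Unrestricted direct product of a possibly infinite family of groups. The   *)
(* alias keeps the componentwise group law from becoming an instance on every *)
(* dependent function type; the choice structure is classical (boolp).        *)
Definition group_product (I : Type) (G : I -> groupType) : Type :=
  forall i, G i.

Section DirectProduct.
Variables (I : Type) (G : I -> groupType).

HB.instance Definition _ := gen_eqMixin (group_product G).
HB.instance Definition _ := gen_choiceMixin (group_product G).

Let one : group_product G := fun=> 1.
Let inv (x : group_product G) : group_product G := fun i => (x i)^-1.
Let mul (x y : group_product G) : group_product G := fun i => x i * y i.

Let mulA : associative mul.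
Proof. by move=> x y z; apply: functional_extensionality_dep => i; apply: mulgA. Qed.
Let mul1 : left_id one mul.
Proof. by move=> x; apply: functional_extensionality_dep => i; apply: mul1g. Qed.
Let mulr1 : right_id one mul.
Proof. by move=> x; apply: functional_extensionality_dep => i; apply: mulg1. Qed.
Let mulV : left_inverse one inv mul.
Proof. by move=> x; apply: functional_extensionality_dep => i; apply: mulVg. Qed.
Let mulrV : right_inverse one inv mul.
Proof. by move=> x; apply: functional_extensionality_dep => i; apply: mulgV. Qed.

HB.instance Definition _ :=
  isGroup.Build (group_product G) mulA mul1 mulr1 mulV mulrV.

End DirectProduct.

Definition isomorphic (G H : groupType) : Prop :=
  exists f : {multiplicative G -> H}, bijective f.

(* Subgroups and quotients are taken up to isomorphism, so a variety is       *)
(* closed under isomorphism.                                                  *)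
Definition is_subgroup (H G : groupType) : Prop :=
  exists f : {multiplicative H -> G}, injective f.

Definition is_quotient (Q G : groupType) : Prop :=
  exists f : {multiplicative G -> Q}, forall y, exists x, f x = y.

Record variety (V : groupType -> Prop) : Prop := Variety {
  variety_quotient : forall G Q, V G -> is_quotient Q G -> V Q;
  variety_subgroup : forall G H, V G -> is_subgroup H G -> V H;
  variety_product : forall (I : Type) (G : I -> groupType),
    (forall i, V (G i)) -> V (group_product G)
}.

Definition Var (X : groupType -> Prop) (G : groupType) : Prop :=
  forall V, variety V -> (forall H, X H -> V H) -> V G.

Lemma Var_variety X : variety (Var X).
Proof.
split.
- move=> G Q VG qQ V vV XV; exact: (variety_quotient vV (VG V vV XV) qQ).
- move=> G H VG sH V vV XV; exact: (variety_subgroup vV (VG V vV XV) sH).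
- move=> I G VG V vV XV; apply: (variety_product vV) => i; exact: VG.
Qed.

Lemma sub_Var X G : X G -> Var X G.
Proof. by move=> XG V _; apply. Qed.

Definition finitely_generated (G : groupType) : Prop :=
  exists s : seq G, forall A : {pred G},
    group_closed A -> {subset s <= A} -> forall x, x \in A.

(* [subg_of A] is the group A regarded as a type.                             *)
Definition subfactor (G : finGroupType) (Q : groupType) : Prop :=
  exists H N : {group G}, N <| H /\ isomorphic Q (subg_of (H / N)).

Definition proper_subfactor (G : finGroupType) (Q : groupType) : Prop :=
  exists H N : {group G},
    [/\ N <| H, ~ (H :=: [set: G] /\ N :=: 1) & isomorphic Q (subg_of (H / N))].

(* Main.v *)
(* [G] satisfies all laws of the [S i]; being generated by k elements, it is  *)
(* a quotient of the subgroup [F] generated by the k tuples of coordinate     *)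
(* functions in the finite product of copies of the [S i] indexed by all      *)
(* k-tuples. Call a finite group decomposable if it is a direct product of    *)
(* copies of the [S i] and of a group in the variety [W] of the proper        *)
(* subfactors. If [L2] is normal in [F] with [F / L2] simple nonabelian, then *)
(* either [L1] is contained in [L2] or [F / (L1 :&: L2)] is the direct product*)
(* of [F / L1] and [F / L2]. Intersecting first the kernels of the            *)
(* projections of [F] that are not onto a factor, which gives a quotient in   *)
(* [W], and then the remaining ones, shows that [F] is decomposable. Finally, *)
(* decomposability passes to quotients because the [S i] are centreless.      *)
Require Import Defs.
From HB Require Import structures.
From mathcomp Require Import all_boot all_fingroup all_solvable.
From mathcomp Require Import boolp.

Set Implicit Arguments.
Unset Strict Implicit.
Unset Printing Implicit Defensive.

Local Open Scope group_scope.

(** [Var_fg_finite] presents [G] as a quotient of a subgroup [F] of a finite product of copies of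
    the [S i]: a law in [k] variables only has to be tested on the finitely many [k]-tuples in the
    [S i]. Each coordinate projection of [F] is either onto its factor or has a proper subgroup, a
    member of [W], as image. Adding the coordinates one at a time, [decomposable_quotientI] shows
    that a new simple quotient is either already accounted for or splits off as a direct factor,
    whence [decomposable_subproduct]. [decomposable_morphim] carries the decomposition over to
    [F / N], and [decomposable_isomorphic] collects the simple factors into powers. *)

(** * Homomorphisms and isomorphisms *)

Section Multiplicative.
Variables (G H : groupType) (f : G -> H) (fM : {morph f : x y / x * y}).

Definition multiplicative_of : {multiplicative G -> H} :=
  HB.pack f (isMultiplicative.Build G H f fM).

Lemma isomorphic_can (g : H -> G) : cancel f g -> cancel g f -> isomorphic G H.
Proof. by move=> fK gK; exists multiplicative_of; exists g. Qed.

Lemma isomorphic_bij : injective f -> (forall y, exists x, f x = y) ->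
  isomorphic G H.
Proof.
move=> fI /choice[g gK]; apply: (isomorphic_can _ gK) => x.
by apply: fI; rewrite gK.
Qed.

Lemma morph_is_subgroup : injective f -> is_subgroup G H.
Proof. by exists multiplicative_of. Qed.

Lemma morph_is_quotient : (forall y, exists x, f x = y) -> is_quotient H G.
Proof. by exists multiplicative_of. Qed.

End Multiplicative.

Section GroupMorphism.
Variables (G H : groupType) (f : {multiplicative G -> H}).

Lemma multiplicative1 : f 1 = 1.
Proof. by apply: (mulgI (f 1)); rewrite -gmulfM !mulg1. Qed.

Lemma multiplicativeV x : f x^-1 = (f x)^-1.
Proof. by apply: (mulgI (f x)); rewrite -gmulfM !mulgV multiplicative1. Qed.

End GroupMorphism.

Lemma isomorphic_refl (G : groupType) : isomorphic G G.
Proof. exact: (@isomorphic_can _ _ id _ id). Qed.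

Lemma isomorphic_sym (G H : groupType) : isomorphic G H -> isomorphic H G.
Proof.
case=> f [g fK gK]; apply: (@isomorphic_can _ _ g _ f) => //.
exact: can2_gmulfM fK gK.
Qed.

Lemma isomorphic_trans (G H K : groupType) :
  isomorphic G H -> isomorphic H K -> isomorphic G K.
Proof.
case=> f fbij [g gbij]; case: (bij_comp gbij fbij) => h hK Kh.
by apply: isomorphic_can hK Kh => x y; rewrite /= !gmulfM.
Qed.

Lemma isomorphic_mul (G1 G2 H1 H2 : groupType) :
  isomorphic G1 H1 -> isomorphic G2 H2 -> isomorphic (G1 * G2)%type (H1 * H2)%type.
Proof.
case=> f1 [g1 fK1 gK1] [f2 [g2 fK2 gK2]].
apply: (@isomorphic_can _ _ (fun x => (f1 x.1, f2 x.2)) _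
                        (fun y => (g1 y.1, g2 y.2))).
- by move=> x y; congr (_, _); rewrite /= gmulfM.
- by case=> x y /=; rewrite fK1 fK2.
- by case=> x y /=; rewrite gK1 gK2.
Qed.

Lemma isomorphic_mulA (G1 G2 G3 : groupType) :
  isomorphic (G1 * (G2 * G3))%type (G1 * G2 * G3)%type.
Proof.
apply: (@isomorphic_can _ _ (fun x => ((x.1, x.2.1), x.2.2)) _
                        (fun y => (y.1.1, (y.1.2, y.2)))) => //.
- by case=> x [y z].
- by case=> [[x y] z].
Qed.

Lemma isog_isomorphic (aT rT : finGroupType) (A : {group aT}) (B : {group rT}) :
  A \isog B -> isomorphic (subg_of A) (subg_of B).
Proof.
case/isogP=> f /injmP fI fA.
have sB x : x \in A -> f x \in B by move=> Ax; rewrite -fA mem_morphim.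
apply: (@isomorphic_bij _ _ (fun x : subg_of A => subg B (f (sgval x)))).
- move=> x y; apply: val_inj.
  by rewrite /= !subgK ?morphM ?groupM ?sB ?subgP.
- move=> x y /(congr1 sgval); rewrite !subgK ?sB ?subgP // => /fI.
  by move=> E; apply/val_inj/E; rewrite ?subgP.
- move=> y; have /morphimP[x _ Ax yE] : sgval y \in f @* A by rewrite fA subgP.
  by exists (subg A x); rewrite subgK // -yE sgvalK.
Qed.

Lemma isomorphic_subg_setT (gT : finGroupType) : isomorphic gT (subg_of [set: gT]).
Proof.
apply: (@isomorphic_can _ _ (subg [set: gT]) _ sgval).
- by move=> x y; apply: val_inj; rewrite /= !subgK ?inE.
- by move=> x; rewrite subgK ?inE.
- exact: sgvalK.
Qed.

(** * Words, laws and finitely generated groups *)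

Fixpoint word_eval (k : nat) (H : groupType) (h : 'I_k -> H)
    (w : seq (bool * 'I_k)) : H :=
  if w is (b, j) :: w' then
    (if b then h j else (h j)^-1) * word_eval h w'
  else 1.

Definition word_inv (k : nat) (w : seq (bool * 'I_k)) : seq (bool * 'I_k) :=
  rev [seq (~~ bj.1, bj.2) | bj <- w].

Section Words.
Variable k : nat.
Implicit Types (H : groupType) (w : seq (bool * 'I_k)).

Lemma word_eval_cat H (h : 'I_k -> H) w1 w2 :
  word_eval h (w1 ++ w2) = word_eval h w1 * word_eval h w2.
Proof.
by elim: w1 => [|[b j] w1 IH] /=; rewrite ?mul1g // IH mulgA.
Qed.

Lemma word_eval_inv H (h : 'I_k -> H) w :
  word_eval h (word_inv w) = (word_eval h w)^-1.
Proof.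
rewrite /word_inv; elim: w => [|[b j] w IH] /=; first by rewrite invg1.
rewrite rev_cons -cats1 word_eval_cat IH invgM /=.
by case: b; rewrite /= mulg1 ?invgK.
Qed.

Lemma word_eval_morph (H H' : groupType) (f : {multiplicative H -> H'})
    (h : 'I_k -> H) w :
  f (word_eval h w) = word_eval (f \o h) w.
Proof.
elim: w => [|[b j] w IH] /=; first exact: multiplicative1.
by rewrite gmulfM IH; case: b; rewrite ?multiplicativeV.
Qed.

End Words.

Definition satisfies_laws (X : groupType -> Prop) (H : groupType) : Prop :=
  forall k (w : seq (bool * 'I_k)),
    (forall (H' : groupType) (h : 'I_k -> H'), X H' -> word_eval h w = 1) ->
  forall h : 'I_k -> H, word_eval h w = 1.

(** This is the easy half of Birkhoff's theorem: laws pass to quotients by lifting the values of the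
    variables, to subgroups by injectivity, and to products coordinatewise. *)
Lemma satisfies_laws_variety X : variety (satisfies_laws X).
Proof.
split.
- move=> H Q lawH [f /choice[g gK]] k w wX h.
  have -> : h = f \o (g \o h) by apply: funext => j; rewrite /= gK.
  by rewrite -word_eval_morph lawH // multiplicative1.
- move=> H H' lawH [f fI] k w wX h; apply: fI.
  by rewrite word_eval_morph lawH // multiplicative1.
- move=> I H lawH k w wX h; apply: functional_extensionality_dep => i.
  have pM : {morph (fun x : group_product H => x i) : x y / x * y} by [].
  rewrite -[LHS]/(multiplicative_of pM _) word_eval_morph.
  exact: lawH.
Qed.

Lemma Var_satisfies_laws X H : Var X H -> satisfies_laws X H.
Proof.
move/(_ _ (satisfies_laws_variety X)); apply=> H' XH' k w wX h.
exact: wX.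
Qed.

(** The values of words in the generators form a subgroup containing the generators, hence
    everything. *)
Lemma fg_words (G : groupType) : finitely_generated G ->
  exists k (g : 'I_k -> G), forall x, exists w, word_eval g w = x.
Proof.
case=> s sG; exists (size s), (fun j => nth 1 s j) => x.
pose A : {pred G} :=
  [pred x | `[< exists w, word_eval (fun j : 'I_(size s) => nth 1 s j) w = x >]].
suff: x \in A by move/asboolP.
apply: sG => [|y /(nthP 1)[j js <-]].
  split; first by apply/asboolP; exists [::].
  move=> y z /asboolP[v <-] /asboolP[w <-]; apply/asboolP.
  by exists (v ++ word_inv w); rewrite word_eval_cat word_eval_inv.
by apply/asboolP; exists [:: (true, Ordinal js)]; rewrite /= mulg1.
Qed.

(* The words evaluated at [gen] form a relatively free group: a word that is  *)
(* trivial at [gen] is a law of all the [S i], hence trivial at [g].          *)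
Lemma Var_fg_finite (I : finType) (S : I -> finGroupType) (G : groupType) :
  finitely_generated G ->
  Var (fun H : groupType => exists i, isomorphic H (S i)) G ->
  exists (T : finType) (t : T -> I)
      (F N : {group {dffun forall a : T, S (t a)}}),
    N <| F /\ isomorphic G (subg_of (F / N)).
Proof.
move=> /fg_words[k [g /choice[word wordK]]] /Var_satisfies_laws lawG.
(* One coordinate for each [i] and each [k]-tuple in [S i]; [gen j] reads off the [j]-th entry of
   the tuple. *)
pose T : finType := {i : I & {ffun 'I_k -> S i}}.
pose t (a : T) : I := tag a.
pose P := {dffun forall a : T, S (t a)}.
pose gen : 'I_k -> P := fun j => [ffun a => (tagged a : {ffun 'I_k -> S (tag a)}) j].
(* An assignment into a copy [H] of [S i] becomes, once transported to [S i], a coordinate [a]; the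
   [a]-component of the word at [gen] is its value under that assignment. *)
have gen_law w : word_eval gen w = 1 -> word_eval g w = 1.
  move=> w1; apply: lawG => H h [i /isomorphic_sym[f [f' fK f'K]]].
  have f'M := can2_gmulfM fK f'K.
  pose h' := [ffun j => f' (h j)].
  pose a : T := Tagged (fun i => {ffun 'I_k -> S i}) h'.
  have projM : {morph (fun x : P => x a) : x y / x * y}.
    by move=> x y; rewrite ffunE.
  have /(congr1 (fun x : P => f (x a))) := w1.
  rewrite -[X in f X = _]/(multiplicative_of projM _) word_eval_morph.
  rewrite word_eval_morph ffunE multiplicative1 => <-; congr (word_eval _ w).
  by apply: funext => j; rewrite /= !ffunE f'K.
pose inF (x : P) := `[< exists w, word_eval gen w = x >].
(* This is the kernel of the map from [F] to [G] that sends the value of a word at [gen] to its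
   value at [g]. In a finite group, closure under products is enough for a subgroup. *)
pose inN (x : P) := `[< exists w, word_eval gen w = x /\ word_eval g w = 1 >].
have inF_group : group_set [set x | inF x].
  apply/group_setP; split=> [|x y]; rewrite !inE.
    by apply/asboolP; exists [::].
  move=> /asboolP[v <-] /asboolP[w <-]; apply/asboolP; exists (v ++ w).
  by rewrite word_eval_cat.
have inN_group : group_set [set x | inN x].
  apply/group_setP; split=> [|x y]; rewrite !inE.
    by apply/asboolP; exists [::].
  move=> /asboolP[v [<- v1]] /asboolP[w [<- w1]]; apply/asboolP.
  by exists (v ++ w); rewrite !word_eval_cat v1 w1 mulg1.
pose F := Group inF_group; pose N := Group inN_group.
have nNF : N <| F.
  apply/andP; split.
    apply/subsetP=> x; rewrite !inE => /asboolP[w [<- _]].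
    by apply/asboolP; exists w.
  apply/subsetP=> x; rewrite !inE => /asboolP[v <-].
  apply/subsetP=> _ /imsetP[y + ->]; rewrite !inE => /asboolP[w [<- w1]].
  apply/asboolP; exists (word_inv v ++ w ++ v).
  by rewrite conjgE !word_eval_cat !word_eval_inv w1 mul1g mulVg.
exists T, t, F, N; split=> //.
have memF w : word_eval gen w \in F by rewrite inE; apply/asboolP; exists w.
have normN w : word_eval gen w \in 'N(N).
  by apply: (subsetP (normal_norm nNF)).
(* If [v w^-1] takes at [gen] the value of a word [u] trivial at [g], then [u (v w^-1)^-1] is
   trivial at [gen], hence at [g] by [gen_law]. *)
have memN v w : (word_eval gen v * (word_eval gen w)^-1 \in N) =
    (word_eval g v == word_eval g w).
  rewrite -word_eval_inv -word_eval_cat inE; apply/asboolP/eqP; last first.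
    move=> vw; exists (v ++ word_inv w); split=> //.
    by rewrite word_eval_cat word_eval_inv vw mulgV.
  case=> u [uE u1].
  have := gen_law (u ++ word_inv (v ++ word_inv w)).
  rewrite word_eval_cat uE word_eval_inv mulgV => /(_ erefl).
  rewrite word_eval_cat u1 mul1g word_eval_inv word_eval_cat word_eval_inv.
  by move/(canRL invgK); rewrite invg1 => /divg1_eq.
have cosetE v w : (coset N (word_eval gen v) == coset N (word_eval gen w)) =
    (word_eval g v == word_eval g w).
  rewrite -memN eq_mulgV1 -morphV // -morphM ?groupV //.
  by apply/eqP/idP; [apply: coset_idr; rewrite groupM ?groupV | apply: coset_id].
(* The choice [word] need not be multiplicative, but by [cosetE] the coset does not depend on the
   word chosen. *)
pose f x := subg (F / N) (coset N (word_eval gen (word x))).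
have fF x : coset N (word_eval gen (word x)) \in F / N by apply: mem_quotient.
apply: (@isomorphic_bij _ _ f).
- move=> x y; apply: val_inj; rewrite /f /= !subgK ?groupM //.
  rewrite -morphM // -word_eval_cat; apply/eqP.
  by rewrite cosetE word_eval_cat !wordK.
- move=> x y /(congr1 sgval); rewrite !subgK // => /eqP.
  by rewrite cosetE !wordK => /eqP.
- move=> y; have /morphimP[x _ + yE] : sgval y \in F / N by apply: subgP.
  rewrite inE => /asboolP[w wE]; exists (word_eval g w); apply: val_inj.
  by rewrite /= subgK // yE -wE; apply/eqP; rewrite cosetE wordK.
Qed.

(** * Closure properties of varieties *)

Section VarietyClosure.
Variables (W : groupType -> Prop) (varW : variety W).

Lemma variety_isomorphic (G H : groupType) : isomorphic G H -> W G -> W H.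
Proof.
move=> /isomorphic_sym[f fbij] WG; apply: (variety_subgroup varW WG).
by exists f; apply: bij_inj.
Qed.

(** The empty product lies in every variety, and a trivial group embeds in it. *)
Lemma variety_trivial (G : groupType) : (forall x : G, x = 1) -> W G.
Proof.
move=> G1; have W0 := variety_product varW (G := fun i : void => of_void _ i)
  (fun i => match i with end).
apply: (variety_subgroup varW W0); apply: (@morph_is_subgroup _ _ (fun=> 1)).
- by move=> x y; rewrite mulg1.
- by move=> x y _; rewrite (G1 x) (G1 y).
Qed.

Lemma variety_mul (G H : groupType) : W G -> W H -> W (G * H)%type.
Proof.
move=> WG WH; pose GH (b : bool) : groupType := if b then G else H.
have WGH : W (group_product GH) by apply: (variety_product varW); case.
apply: (variety_subgroup varW WGH).
pose f (x : G * H) : group_product GH :=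
  fun b => if b as b0 return GH b0 then x.1 else x.2.
apply: (@morph_is_subgroup _ _ f).
- by move=> x y; apply: functional_extensionality_dep; case.
- move=> [x1 x2] [y1 y2] xy.
  by congr (_, _); [apply: (congr1 (@^~ true) xy) | apply: (congr1 (@^~ false) xy)].
Qed.

Lemma variety_isog (aT rT : finGroupType) (A : {group aT}) (B : {group rT}) :
  A \isog B -> W (subg_of A) -> W (subg_of B).
Proof. by move/isog_isomorphic/variety_isomorphic. Qed.

Lemma variety_morphim (aT rT : finGroupType) (D : {group aT})
    (f : {morphism D >-> rT}) (G : {group aT}) :
  G \subset D -> W (subg_of G) -> W (subg_of (f @* G)).
Proof.
move=> /subsetP sGD WG; apply: (variety_quotient varW WG).
have fG x : x \in G -> f x \in f @* G by move=> Gx; rewrite mem_morphim ?sGD.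
apply: (@morph_is_quotient _ _ (fun x => subg (f @* G) (f (sgval x)))).
- move=> x y; apply: val_inj; rewrite /= !subgK ?(fG, groupM, subgP) //.
  by rewrite morphM // sGD ?subgP.
- move=> y; have /morphimP[x _ Gx yE] : sgval y \in f @* G by apply: subgP.
  by exists (subg G x); rewrite subgK // -yE sgvalK.
Qed.

(** Sending [x] to its two cosets embeds [F] in the product of the quotients, since the kernel is
    [L1 :&: L2]. *)
Lemma variety_subdirect (gT : finGroupType) (F L1 L2 : {group gT}) :
  L1 <| F -> L2 <| F -> L1 :&: L2 = 1 ->
  W (subg_of (F / L1)) -> W (subg_of (F / L2)) -> W (subg_of F).
Proof.
move=> nL1 nL2 L12 W1 W2; apply: (variety_subgroup varW (variety_mul W1 W2)).
pose f (L : {group gT}) (x : subg_of F) := subg (F / L) (coset L (sgval x)).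
have fM (L : {group gT}) : L <| F -> {morph f L : x y / x * y}.
  move=> /normal_norm/subsetP nL x y; apply: val_inj.
  rewrite /f /= !subgK ?(mem_quotient, groupM, subgP) //.
  by rewrite morphM ?nL ?subgP.
have f_eq (L : {group gT}) x y : L <| F -> f L x = f L y ->
    sgval x * (sgval y)^-1 \in L.
  move=> /normal_norm/subsetP nL /(congr1 sgval).
  rewrite !subgK ?mem_quotient ?subgP // => xy.
  have [Nx Ny] : sgval x \in 'N(L) /\ sgval y \in 'N(L) by rewrite !nL ?subgP.
  apply: coset_idr; first by rewrite groupM ?groupV.
  rewrite morphM ?groupV // morphV //.
  by apply/eqP; rewrite -eq_mulgV1; apply/eqP.
apply: (@morph_is_subgroup _ (subg_of (F / L1) * subg_of (F / L2))%type
         (fun x => (f L1 x, f L2 x))).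
  by move=> x y; congr (_, _); apply: fM.
move=> x y [/(f_eq _ _ _ nL1) xy1 /(f_eq _ _ _ nL2) xy2]; apply: val_inj.
apply/eqP; rewrite /= eq_mulgV1; apply/eqP/set1gP.
by rewrite -L12 inE xy1.
Qed.

(** This is the subdirect embedding applied to [F / (L1 :&: L2)], whose relevant quotients are given
    by the third isomorphism theorem. *)
Lemma variety_quotientI (gT : finGroupType) (F L1 L2 : {group gT}) :
  L1 <| F -> L2 <| F ->
  W (subg_of (F / L1)) -> W (subg_of (F / L2)) -> W (subg_of (F / (L1 :&: L2))).
Proof.
move=> nL1 nL2 W1 W2; have nL := normalI nL1 nL2.
have third (L : {group gT}) : L <| F -> L1 :&: L2 \subset L -> W (subg_of (F / L)) ->
    W (subg_of (F / (L1 :&: L2) / (L / (L1 :&: L2)))).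
  move=> nLF sL; apply: variety_isog.
  by rewrite isog_sym third_isog.
apply: (@variety_subdirect _ (F / (L1 :&: L2))%G (L1 / (L1 :&: L2))%G
         (L2 / (L1 :&: L2))%G).
- exact: quotient_normal.
- exact: quotient_normal.
- by rewrite -quotientGI ?subsetIl //= trivg_quotient.
- by apply: third; rewrite ?subsetIl.
- by apply: third; rewrite ?subsetIr.
Qed.

End VarietyClosure.

(** * Decomposable groups *)

Lemma simple_center1 (gT : finGroupType) (A : {group gT}) :
  simple A -> ~~ abelian A -> 'Z(A) = 1.
Proof.
case/simpleP=> _ /(_ _ (center_normal A))[] // ZA.
by rewrite -ZA center_abelian.
Qed.

Section Decomposable.
Variables (I : Type) (S : I -> finGroupType).
Hypothesis S_simple : forall i, simple [set: S i].
Hypothesis S_nonabelian : forall i, ~ abelian [set: S i].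
Variables (W : groupType -> Prop) (varW : variety W).

(** Splitting off one simple factor at a time avoids exponents and lets the proofs proceed by
    induction on the number of factors. *)
Inductive decomposable (gT : finGroupType) (G : {group gT}) : Prop :=
| decomposable_variety : W (subg_of G) -> decomposable G
| decomposable_dprod i (A B : {group gT}) :
    A \x B = G -> [set: S i] \isog A -> decomposable B -> decomposable G.

(** As [A] is simple, the kernel meets it in 1 or in [A]. In the latter case [A] dies and the image
    is that of [B]. In the former [f @* A] is a copy of [S i]; its intersection with [f @* B] is
    central in it, hence trivial, so the product stays direct. *)
Lemma decomposable_morphim (aT rT : finGroupType) (D : {group aT})
    (f : {morphism D >-> rT}) (G : {group aT}) :
  G \subset D -> decomposable G -> decomposable (f @* G).
Proof.
move=> + decG; elim: G / decG => [G WG|G i A B defG isoA _ IH] sGD.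
  by apply: decomposable_variety; apply: variety_morphim.
have [sAG sBG] : A \subset G /\ B \subset G.
  by case/dprodP: defG => _ <- _ _; rewrite mulG_subl mulG_subr.
have sAD := subset_trans sAG sGD; have sBD := subset_trans sBG sGD.
have simA : simple A by rewrite -(isog_simple isoA).
have [_ defG' cAB _] := dprodP defG.
have fG : f @* A * f @* B = f @* G by rewrite -morphimMl ?defG'.
have [|kerA] := (simpleP _ simA).2 ('ker_A f)%G (normalGI sAD (ker_normal f)).
  move=> kerA; have isofA : A \isog f @* A.
    apply: isog_trans (first_isog_loc f sAD); rewrite kerA.
    exact: quotient1_isog.
  have cfAB : f @* B \subset 'C(f @* A) by apply: morphim_cents.
  apply: decomposable_dprod (isog_trans isoA isofA) (IH sBD).
  rewrite dprodE //; apply/trivgP.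
  rewrite -(@simple_center1 _ (f @* A)%G) ?setIS //=.
    by rewrite -(isog_simple isofA).
  by rewrite -(isog_abelian isofA) -(isog_abelian isoA); apply/negP/S_nonabelian.
have fA1 : f @* A = 1.
  by apply/trivgP; rewrite sub_morphim_pre // -kerE -{1}kerA subsetIr.
suff -> : (f @* G)%G = (f @* B)%G by apply: IH.
by apply: val_inj; rewrite /= -fG fA1 mul1g.
Qed.

Lemma decomposable_isog (aT rT : finGroupType) (A : {group aT})
    (B : {group rT}) :
  A \isog B -> decomposable A -> decomposable B.
Proof.
case/isogP=> f _ fA decA; suff <- : (f @* A)%G = B.
  exact: decomposable_morphim.
exact: val_inj.
Qed.

(** Unless [L1] lies in [L2], its image in the simple group [F / L2] is everything, so
    [L1 * L2 = F]. Modulo [L1 :&: L2], which contains their commutators, [F] is then the direct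
    product of [L1], a copy of [F / L2], and [L2], a copy of [F / L1]. *)
Lemma decomposable_quotientI (gT : finGroupType) (F L1 L2 : {group gT}) i :
  L1 <| F -> L2 <| F -> decomposable (F / L1) -> [set: S i] \isog F / L2 ->
  decomposable (F / (L1 :&: L2)).
Proof.
move=> nL1 nL2 dec1 iso2.
have [sL12|nsL12] := boolP (L1 \subset L2).
  by rewrite (setIidPl sL12).
have nL12 : L1 \subset 'N(L2) := subset_trans (normal_sub nL1) (normal_norm nL2).
have nL21 : L2 \subset 'N(L1) := subset_trans (normal_sub nL2) (normal_norm nL1).
have sim2 : simple (F / L2) by rewrite -(isog_simple iso2).
have [/trivgP|L1F] := (simpleP _ sim2).2 (L1 / L2)%G (quotient_normal _ nL1).
  by rewrite quotient_sub1 // (negPf nsL12).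
have defF : L1 * L2 = F.
  have := congr1 (fun A : {set _} => coset L2 @*^-1 A) L1F.
  by rewrite /= (quotientGK nL2) quotientK // normC.
pose L := (L1 :&: L2)%G.
apply: (@decomposable_dprod _ (F / L)%G i (L1 / L)%G (L2 / L)%G).
- rewrite dprodE.
  + by rewrite -quotientMl ?defF // (subset_trans (normal_sub nL1)) ?normal_norm ?normalI.
  + rewrite quotient_cents2r // subsetI commg_subl commg_subr.
    by rewrite nL12 nL21.
  + by rewrite -quotientGI ?subsetIl //= trivg_quotient.
- apply: isog_trans iso2 _; rewrite -L1F isog_sym /= setIC.
  exact: second_isog.
- apply: decomposable_isog dec1; rewrite isog_sym.
  rewrite /= -defF quotientMidl.
  exact: second_isog.
Qed.

Hypothesis W_proper : forall i H, proper_subfactor (S i) H -> W H.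

Lemma decomposable_subproduct (T : finType) (t : T -> I)
    (F : {group {dffun forall a : T, S (t a)}}) : decomposable F.
Proof.
pose proj a := @dffun_morphism T (fun a => S (t a)) a.
pose D a := ('ker_F (proj a))%G.
have nD a : D a <| F by apply: normalGI (subsetT _) (ker_normal _).
have isoD a : F / D a \isog proj a @* F by apply: first_isog_loc (subsetT _).
pose full a := proj a @* F == [set: S (t a)].
have WD a : ~~ full a -> W (subg_of (F / D a)).
  (* The image of the projection, divided by the trivial group, is a proper subfactor. *)
  move/eqP=> nfull; apply: (W_proper (i := t a)).
  exists (proj a @* F)%G, 1%G; split; first exact: normal1.
    by case.
  apply: isog_isomorphic; apply: isog_trans (isoD a) _.
  exact: quotient1_isog.
have decD a : full a -> [set: S (t a)] \isog F / D a.
  by move/eqP=> <-; rewrite isog_sym.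
have [L0 [nL0 sL0 WL0]] : exists L0 : {group {dffun forall a : T, S (t a)}},
    [/\ L0 <| F, forall a, ~~ full a -> L0 \subset D a & W (subg_of (F / L0))].
  suff [L0 [nL0 sL0 WL0]] : exists L0 : {group {dffun forall a : T, S (t a)}},
      [/\ L0 <| F, forall a, a \in enum T -> ~~ full a -> L0 \subset D a
        & W (subg_of (F / L0))].
    by exists L0; split=> // a; apply: sL0; rewrite mem_enum.
  elim: (enum T) => [|a r [L [nL sL WL]]].
    (* The empty intersection is [F] itself, and [F / F] is trivial. *)
    exists F; split=> //; apply: variety_trivial => // x; apply: val_inj.
    have sFF1 : F / F \subset [1] by rewrite trivg_quotient.
    exact/set1gP/(subsetP sFF1)/subgP.
  have [fa|nfa] := boolP (full a).
    exists L; split=> // b; rewrite inE => /predU1P[->|]; last exact: sL.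
    by rewrite fa.
  exists (L :&: D a)%G; split; first exact: normalI nL (nD a).
    move=> b; rewrite inE => /predU1P[-> _|br nfb]; first exact: subsetIr.
    exact: subset_trans (subsetIl _ _) (sL b br nfb).
  by apply: variety_quotientI => //; apply: WD.
(* The intersection now starts from [L0], whose quotient is decomposable because it lies in [W];
   each full coordinate adds at most one simple factor. *)
have [L [nL sLL0 sL decL]] : exists L : {group {dffun forall a : T, S (t a)}},
    [/\ L <| F, L \subset L0, forall a, a \in enum T -> full a -> L \subset D a
      & decomposable (F / L)].
  elim: (enum T) => [|a r [L [nL sLL0 sL decL]]].
    by exists L0; split=> //; apply: decomposable_variety.
  have [fa|nfa] := boolP (full a); last first.
    exists L; split=> // b; rewrite inE => /predU1P[->|]; last exact: sL.
    by rewrite (negPf nfa).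
  exists (L :&: D a)%G; split; first exact: normalI nL (nD a).
  - exact: subset_trans (subsetIl _ _) sLL0.
  - move=> b; rewrite inE => /predU1P[-> _|br fb]; first exact: subsetIr.
    exact: subset_trans (subsetIl _ _) (sL b br fb).
  - exact: decomposable_quotientI (decD a fa).
(* An element of [L] is killed by every coordinate projection. *)
have L1 : L :=: 1.
  apply/trivgP/subsetP=> x Lx; apply/set1gP/ffunP=> a.
  have sLD : L \subset D a.
    have [fa|nfa] := boolP (full a); first by apply: sL; rewrite ?mem_enum.
    exact: subset_trans sLL0 (sL0 a nfa).
  have /setIP[_ /mker] := subsetP sLD x Lx.
  by rewrite oneg_ffun.
apply: decomposable_isog decL; rewrite L1 isog_sym.
exact: quotient1_isog.
Qed.

End Decomposable.

(** * Powers of the simple factors and the conclusion *)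

Lemma isomorphic_mul_power (I : eqType) (S : I -> finGroupType) (m : I -> nat)
    (i : I) :
  isomorphic (S i * group_product (fun j => {ffun 'I_(m j) -> S j}))%type
    (group_product (fun j => {ffun 'I_(m j + (i == j)) -> S j})).
Proof.
pose Pm := group_product (fun j => {ffun 'I_(m j) -> S j}).
pose Pm' := group_product (fun j => {ffun 'I_(m j + (i == j)) -> S j}).
have i0 : 0 < (i == i) by rewrite eqxx.
(* The element [s] is transported along [i = j]. The default 1 is never reached, since ['I_(i == j)]
   is empty when [i] and [j] differ. *)
pose new (s : S i) j (b : 'I_(i == j)) : S j :=
  if i =P j is ReflectT e then ecast k (S k) e s else 1.
have new_id s b : new s i b = s.
  by rewrite /new; case: eqP => // e; rewrite eq_axiomK.
pose f (x : S i * Pm) : Pm' := fun j =>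
  [ffun c => match split c with inl b => x.2 j b | inr b => new x.1 j b end].
pose g (y : Pm') : S i * Pm :=
  (y i (rshift (m i) (Ordinal i0)), fun j => [ffun b => y j (lshift _ b)]).
apply: (@isomorphic_can _ _ f _ g).
- move=> x y; apply: functional_extensionality_dep => j; apply/ffunP=> c.
  rewrite !ffunE; case: split => b; first by rewrite ffunE.
  by rewrite /new; case: eqP => [e|]; rewrite ?mulg1 //; case: _ / e.
- case=> s p; congr (_, _).
    by rewrite ffunE -[rshift _ _]/(unsplit (inr _)) unsplitK new_id.
  apply: functional_extensionality_dep => j; apply/ffunP=> b.
  by rewrite !ffunE -[lshift _ _]/(unsplit (inl _)) unsplitK.
- move=> y; apply: functional_extensionality_dep => j; apply/ffunP=> c.
  rewrite ffunE -{2}[c]splitK; case: split => b /=; first by rewrite ffunE.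
  (* The mere existence of [b] forces [i = j], and [b] is then the only element of ['I_1]. *)
  have ij : i = j by apply/eqP; case: (i == j) b => // -[].
  case: _ / ij b => b; rewrite new_id; congr (y i (rshift _ _)).
  by apply: val_inj; case: b => -[|b] //=; rewrite eqxx.
Qed.

Lemma decomposable_isomorphic (I : eqType) (S : I -> finGroupType)
    (W : groupType -> Prop) (gT : finGroupType) (G : {group gT}) :
  decomposable S W G ->
  exists (m : I -> nat) (K : groupType),
    isomorphic (subg_of G)
      (group_product (fun i => {ffun 'I_(m i) -> S i}) * K)%type /\ W K.
Proof.
elim=> {}G => [WG|i A B defG isoA _ [m [K [isoB WK]]]].
  (* With all exponents zero the product of powers is trivial, and [K] is the whole group. *)
  exists (fun=> 0), (subg_of G); split=> //; apply: isomorphic_sym.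
  apply: (@isomorphic_bij _ _ snd) => //.
    move=> [p x] [q y] /= ->; congr (_, _).
    by apply: functional_extensionality_dep => i; apply/ffunP=> -[].
  by move=> x; exists (1, x).
exists (fun j => m j + (i == j)), K; split=> //.
have isoG : isomorphic (subg_of G) (subg_of A * subg_of B)%type.
  have [_ AB cAB tAB] := dprodP defG.
  have [sAG sBG] : A \subset G /\ B \subset G.
    by rewrite -AB mulG_subl mulG_subr.
  have ABG (x : subg_of A * subg_of B) : sgval x.1 * sgval x.2 \in G.
    by rewrite -AB mem_mulg ?subgP.
  apply: isomorphic_sym; apply: (@isomorphic_bij (subg_of A * subg_of B)%type _
    (fun x => subg G (sgval x.1 * sgval x.2))).
  - move=> x y; apply: val_inj.
    rewrite /= !subgK ?ABG //; last exact: (ABG (x * y)).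
    rewrite !mulgA; congr (_ * _); rewrite -!mulgA; congr (_ * _).
    by apply/esym/(centsP cAB); rewrite subgP.
  - move=> [x1 x2] [y1 y2] /(congr1 sgval); rewrite !subgK ?ABG //= => xy.
    (* From [x1 x2 = y1 y2] the element [y1^-1 x1 = y2 x2^-1] lies in both [A] and [B], hence is
       1. *)
    suff E : x1 = y1 by move: xy; rewrite E => /mulgI/val_inj->.
    apply: val_inj; apply/eqP; rewrite /= eq_sym eq_mulVg1.
    apply/eqP/set1gP; rewrite -tAB inE groupM ?groupV ?subgP //=.
    rewrite (_ : _ * _ = sgval y2 * (sgval x2)^-1) ?groupM ?groupV ?subgP //.
    by apply: (mulgI (sgval y1)); rewrite mulKVg mulgA -xy mulgK.
  - move=> z; have : sgval z \in A * B by rewrite AB subgP.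
    case/mulsgP=> x y Ax By zE; exists (subg A x, subg B y).
    by apply: val_inj; rewrite /= !subgK // -zE subgP.
apply: isomorphic_trans isoG _.
have isoSi : isomorphic (subg_of A) (S i).
  apply: isomorphic_sym; apply: isomorphic_trans (isomorphic_subg_setT _) _.
  exact: (isog_isomorphic isoA).
apply: isomorphic_trans (isomorphic_mul isoSi isoB) _.
apply: isomorphic_trans (isomorphic_mulA _ _ _) _.
exact: isomorphic_mul (isomorphic_mul_power _ _ _) (isomorphic_refl _).
Qed.

Theorem theorem4p25 (n : nat) (S : 'I_n -> finGroupType)
    (S_simple : forall i, simple [set: S i])
    (S_nonabelian : forall i, ~ abelian [set: S i])
    (S_no_subfactor : forall i j, i <> j -> ~ subfactor (S j) (S i))
    (G : groupType)
    (G_fg : finitely_generated G)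
    (G_in_V : Var (fun H : groupType => exists i, isomorphic H (S i)) G) :
  exists (m : 'I_n -> nat) (K : groupType),
    isomorphic G
      (group_product (fun i : 'I_n => {ffun 'I_(m i) -> S i}) * K)%type /\
    Var (fun H : groupType => exists i, proper_subfactor (S i) H) K.
Proof.
pose W := Var (fun H : groupType => exists i, proper_subfactor (S i) H).
have varW : variety W by apply: Var_variety.
have W_proper i H : proper_subfactor (S i) H -> W H.
  by move=> iH; apply: sub_Var; exists i.
have [T [t [F [N [nNF isoG]]]]] := Var_fg_finite G_fg G_in_V.
have decF := decomposable_subproduct S_simple S_nonabelian varW W_proper F.
have decFN : decomposable S W (F / N).
  exact: decomposable_morphim (normal_norm nNF) decF.
have [m [K [isoFN WK]]] := decomposable_isomorphic decFN.
by exists m, K; split=> //; apply: isomorphic_trans isoFN.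
Qed.
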